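(* Let $A$ and $B$ be connected finite functional graphs and let $p_X\ge 1$ be an integer. Then, up to isomorphism, there are at most $|\mathcal P_A|$ connected finite functional graphs $X$ with $|\mathcal P_X|=p_X$ satisfying $A\times X\supseteq B$.
   Context: A functional graph (FG) is a directed graph $G=(V,E)$ in which each vertex has exactly one outgoing edge; it represents the function $f:V\to V$ with $E=\{(u,v): v=f(u)\}$. All FGs are finite and are considered up to isomorphism. An FG is connected if its underlying undirected graph is connected; a connected FG has exactly one cycle. A vertex $v$ is cyclic if $f^p(v)=v$ for some integer $p>0$, and $\mathcal P_G$ denotes the set of cyclic vertices of $G$ (so for connected $G$, $|\mathcal P_G|$ is the length of its unique cycle). The direct product $G\times G'$ of FGs $G=(V,E)$ and $G'=(V',E')$ has vertex set $V\times V'$ and edge set $\{((v,v'),(u,u')) : (v,u)\in E,\ (v',u')\in E'\}$; it is again an FG. For connected FGs $A,X,B$, the notation $A\times X\supseteq B$ means that $B$ is isomorphic to a connected component of $A\times X$ (when $\gcd(|\mathcal P_A|,|\mathcal P_X|)=1$ the product is connected and this means $A\times X\cong B$). *)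

(* Defs.v *)
From mathcomp Require Import all_boot.

Set Implicit Arguments.
Unset Strict Implicit.
Unset Printing Implicit Defensive.

Record fungraph := FunGraph { vertex :> finType; succ : vertex -> vertex }.

Definition edge (G : fungraph) : rel G := [rel u v | v == succ u].

Definition adj (G : fungraph) : rel G := [rel u v | edge u v || edge v u].

(* The empty graph is not connected: a connected FG has exactly one cycle. *)
Definition connected (G : fungraph) : Prop :=
  0 < #|G| /\ forall u v : G, connect (@adj G) u v.

Definition isomorphic (G H : fungraph) : Prop :=
  exists2 h : G -> H, bijective h & forall u v, edge (h u) (h v) = edge u v.

Definition cyclic_vertex (G : fungraph) (v : G) : Prop :=
  exists2 p, 0 < p & iter p (@succ G) v = v.

Definition cyclicb (G : fungraph) (v : G) : bool :=
  fconnect (@succ G) (succ v) v.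

Lemma cyclicP (G : fungraph) (v : G) : reflect (cyclic_vertex v) (cyclicb v).
Proof.
apply: (iffP idP) => [/iter_findex e | [[//|p] _ e]].
  by exists (findex (@succ G) (succ v) v).+1; rewrite // iterSr.
by rewrite /cyclicb -{2}e iterSr fconnect_iter.
Qed.

Definition cyclic_vertices (G : fungraph) : {set G} := [set v | cyclicb v].

Definition fg_prod (G H : fungraph) : fungraph :=
  @FunGraph (G * H)%type (fun x => (succ x.1, succ x.2)).

Lemma edge_prod (G H : fungraph) (x y : fg_prod G H) :
  edge x y = edge x.1 y.1 && edge x.2 y.2.
Proof. by case: x y => [u u'] [v v']. Qed.

Lemma connect_adj_succ (G : fungraph) (v u : G) :
  connect (@adj G) v u -> connect (@adj G) v (succ u).
Proof.
by move/connect_trans; apply; apply: connect1; rewrite /adj /edge /= eqxx.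
Qed.

Definition comp_vertex (G : fungraph) (v : G) : finType :=
  {u : G | connect (@adj G) v u}.

Definition comp_succ (G : fungraph) (v : G) (u : comp_vertex v) :
    comp_vertex v :=
  exist _ (succ (val u)) (connect_adj_succ (valP u)).

Definition component (G : fungraph) (v : G) : fungraph :=
  FunGraph (@comp_succ G v).

Definition prod_contains (A X B : fungraph) : Prop :=
  exists v : fg_prod A X, isomorphic B (component v).

(* Main.v *)
Require Import Defs.
From mathcomp Require Import all_boot.
From mathcomp Require Import ssralg ssrnum ssrint boolp.

Set Implicit Arguments.
Unset Strict Implicit.
Unset Printing Implicit Defensive.

(** Unroll a functional graph backwards from a cyclic vertex [v]: the vertices
    [u] with [iter k succ u = v], placed at level [k], form an infinite tree
    rooted at [v].  The unrolling of a product at [(a, x)] is the levelwise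
    product of the unrollings at [a] and [x], and a connected graph can be
    recovered from the unrolling at one cyclic vertex and its period.

    Fix a cyclic vertex [b] of [B].  An isomorphism of [B] onto a component of
    [A * X] sends [b] to a pair [(a, x)] of cyclic vertices.  The theorem
    follows from the claim that, for a given period, [a] determines [X] up to
    isomorphism: the [X i] then inject into the cyclic vertices of [A].

    The claim is a cancellation property, proved as in Lovasz's cancellation
    theorem by counting homomorphisms [hom t v] from finite rooted trees [t]
    into the unrolling at [v].  These numbers are multiplicative ([hom_prod]),
    and positive at a cyclic vertex ([hom_cyclic_gt0]), so
    [hom t b = hom t a * hom t x] determines [hom t x] for every [t].
    It remains to reconstruct [X] from the counts at [x].  Gluing two trees at
    their roots multiplies the counts, so the functions [hom t] form a
    multiplicative monoid; by an argument of Vandermonde type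
    ([class_weight_eq0]) the sums of all these functions over a finite multiset
    of vertices determine how many of its elements have each given family of
    counts.  Applied to the predecessors of a vertex, this says that two
    vertices with the same counts have predecessors that match, with
    multiplicities ([same_homs_fibres]).  An isomorphism can then be grown
    backwards, one vertex at a time, from the cycle through [x]
    ([same_homs_embedding]). *)

(** * Separating multiplicative families of functions *)

Section Separation.
Import GRing.Theory.
Local Open Scope ring_scope.

(** A weight [m] orthogonal to every function of a multiplicative family has
    zero total on each class [C] of points that the family does not
    distinguish.  Induction on the support of [m]: a support point [i1]
    outside [C] is told apart from [C] by some [h t], and multiplying [m] by
    [h t - h t i1] removes [i1] from the support, preserves orthogonality
    because the family is multiplicative, and only rescales [m] on [C] by a
    nonzero constant. *)
Lemma class_weight_eq0 (R : idomainType) (I : finType) (T : Type)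
    (h : T -> I -> R) (one : T) (mul : T -> T -> T)
    (h1 : forall i, h one i = 1)
    (hM : forall s t i, h (mul s t) i = h s i * h t i)
    (i0 : I) (C : pred I)
    (eqC : forall i t, C i -> h t i = h t i0)
    (sepC : forall i, ~~ C i -> exists t, h t i != h t i0)
    (m : I -> R) :
  (forall t, \sum_i m i * h t i = 0) -> \sum_(i | C i) m i = 0.
Proof.
have [k] := ubnP #|[set i | m i != 0]|.
elim: k => // k IHk in m *; rewrite ltnS => le_k m_ann.
case: (pickP (fun i => (m i != 0) && ~~ C i)) => [i1 /andP[m1 nC1] | noi1].
  have [t neq_t] := sepC i1 nC1.
  pose m' i := m i * (h t i - h t i1).
  have m'_ann s : \sum_i m' i * h s i = 0.
    transitivity (\sum_i m i * h (mul t s) i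
                  - h t i1 * \sum_i m i * h s i); last first.
      by rewrite !m_ann mulr0 subr0.
    rewrite mulr_sumr -sumrB; apply: eq_bigr => i _.
    by rewrite hM /m' -mulrA mulrBl mulrBr [h t i1 * (m i * _)]mulrCA.
  have lt_k : (#|[set i | m' i != 0%R]| < k)%N.
    apply: leq_trans le_k; apply: proper_card; apply/properP; split.
      by apply/subsetP=> i; rewrite !inE /m' mulf_eq0 negb_or => /andP[].
    by exists i1; rewrite !inE // /m' subrr mulr0 eqxx.
  have := IHk m' lt_k m'_ann.
  have -> : \sum_(i | C i) m' i = (\sum_(i | C i) m i) * (h t i0 - h t i1).
    by rewrite mulr_suml; apply: eq_bigr => i Ci; rewrite /m' (eqC i t Ci).
  by move/eqP; rewrite mulf_eq0 subr_eq0 [_ == h t i1]eq_sym (negPf neq_t) orbF => /eqP.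
rewrite -[RHS](m_ann one) big_mkcond; apply: eq_bigr => i _.
rewrite h1 mulr1; case: ifPn => // nCi.
by have := noi1 i; rewrite nCi andbT => /negbFE/eqP.
Qed.

End Separation.

(** * Counting homomorphisms from rooted trees *)

(** Every finite rooted tree arises from a single vertex by gluing two trees
    at their roots ([Join]) and by adding a new root below the old one
    ([Plant]).  This presentation makes closure under products immediate and
    avoids nested induction on lists of subtrees. *)
Inductive rooted_tree := Leaf | Join of rooted_tree & rooted_tree | Plant of rooted_tree.

(** The number of maps from [t] to [G] that send the root to [v] and the parent
    of a node to the successor of its image. *)
Fixpoint hom (t : rooted_tree) (G : fungraph) (v : G) : nat :=
  match t with
  | Leaf => 1
  | Join t1 t2 => hom t1 v * hom t2 v
  | Plant t' => \sum_(u : G | succ u == v) hom t' u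
  end.

Definition same_homs (G H : fungraph) (v : G) (w : H) : Prop :=
  forall t, hom t v = hom t w.

Lemma same_homs_sym (G H : fungraph) (v : G) (w : H) : same_homs v w -> same_homs w v.
Proof. by move=> vw t; rewrite vw. Qed.

(** A map into a product is a pair of maps. *)
Lemma hom_prod (G H : fungraph) (t : rooted_tree) (p : fg_prod G H) :
  hom t p = hom t p.1 * hom t p.2.
Proof.
elim: t p => [|t1 IH1 t2 IH2|t IHt] p //=; first by rewrite IH1 IH2 mulnACA.
rewrite big_distrlr pair_big; apply: eq_big => [q|q _]; last exact: IHt.
by case: p q => [a x] [a' x'].
Qed.

(** Counts at [v] only see the vertices that lead to [v].  Hence they are kept by
    injections whose image is closed under predecessors, such as isomorphisms
    and inclusions of components. *)
Lemma hom_fibration (G H : fungraph) (g : G -> H) :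
    injective g -> (forall v, g (succ v) = succ (g v)) ->
    (forall w v, succ w = g v -> exists u, g u = w) ->
  forall t v, hom t (g v) = hom t v.
Proof.
move=> g_inj gS g_pred; elim=> [|t1 IH1 t2 IH2|t IHt] v //=.
  by rewrite IH1 IH2.
under [RHS]eq_bigr => u _ do rewrite -IHt.
rewrite -(big_imset (h := g) (A := [pred u | succ u == v]) (hom t (G := H))) /=;
  last by move=> ? ? _ _ /g_inj.
apply: eq_bigl => w; apply/eqP/imsetP => [sw | [u /eqP su ->]]; last by rewrite -gS su.
have [u gu] := g_pred w v sw; exists u => //.
by apply/eqP/g_inj; rewrite gS gu.
Qed.

(** * Cyclic vertices *)

(** By step [#|G|] the trajectory of [v] has met a vertex twice, and from then
    on it stays on a cycle. *)
Lemma cyclic_iter (G : fungraph) (k : nat) (v : G) : #|G| <= k -> cyclic_vertex (iter k (@succ G) v).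
Proof.
move=> le_k.
have /trajectP[i lt_i e] : iter (order (@succ G) v) (@succ G) v
    \in traject (@succ G) v (order (@succ G) v) by exact: looping_order.
have le_ok : order (@succ G) v <= k by apply: leq_trans le_k; exact: max_card.
exists (order (@succ G) v - i); first by rewrite subn_gt0.
have -> : k = (k - i) + i by rewrite subnK // (leq_trans (ltnW lt_i)).
by rewrite -iterD addnCA subnK 1?ltnW // iterD e -iterD.
Qed.

Lemma cyclic_pred (G : fungraph) (v : G) :
  cyclic_vertex v -> exists2 u : G, cyclic_vertex u & succ u = v.
Proof.
case=> [[//|p] _ e]; exists (iter p (@succ G) v) => //.
by exists p.+1 => //; rewrite -iterD addnC iterD e.
Qed.

Lemma iter_period_mul (G : fungraph) (v : G) p k :
  iter p (@succ G) v = v -> iter (k * p) (@succ G) v = v.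
Proof. by move=> e; elim: k => // k IHk; rewrite mulSn iterD IHk. Qed.

(** Iterating [succ] a common multiple of both periods fixes [u] and [v], and the
    first of these iterations already identifies them. *)
Lemma cyclic_succ_inj (G : fungraph) (u v : G) :
  cyclic_vertex u -> cyclic_vertex v -> succ u = succ v -> u = v.
Proof.
move=> [p p_gt0 eu] [q q_gt0 ev] e.
rewrite -(iter_period_mul q eu) -(iter_period_mul p ev) mulnC.
have: 0 < p * q by rewrite muln_gt0 p_gt0.
by case: (p * q) => // k _; rewrite !iterSr e.
Qed.

Lemma cyclic_vertex_iter (G : fungraph) (v : G) k :
  cyclic_vertex v -> cyclic_vertex (iter k (@succ G) v).
Proof. by move=> [p p_gt0 e]; exists p; rewrite // -iterD addnC iterD e. Qed.

(** The set of vertices from which [x] can be reached is closed under adjacency: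
    leaving [x] itself does no harm, since [x] is cyclic. *)
Lemma connected_reach (G : fungraph) (x v : G) :
  connected G -> cyclic_vertex x -> fconnect (@succ G) v x.
Proof.
move=> [_ /(_ v x) conn] /cyclicP cx.
have cl : closed (@adj G) [pred u | fconnect (@succ G) u x].
  have E u : fconnect (@succ G) u x = fconnect (@succ G) (succ u) x.
    apply/idP/idP => [|/(connect_trans (fconnect1 _ u)) //].
    case/connectP=> [[|u1 q] /=]; first by move=> _ <-.
    by case/andP=> /eqP <- pq e; apply/connectP; exists q.
  by move=> u w; rewrite /adj /edge !inE /= => /orP[] /eqP ->; rewrite -E.
by have := closed_connect cl conn; rewrite !inE connect0.
Qed.

(** A connected graph has only one cycle, the orbit of [x]. *)
Lemma order_cyclic (G : fungraph) (x : G) : connected G -> cyclic_vertex x ->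
  order (@succ G) x = #|cyclic_vertices G|.
Proof.
move=> cG cx; rewrite /order; apply: eq_card => v.
rewrite [RHS]inE; apply/idP/cyclicP => [/iter_findex <- | cv].
  exact: cyclic_vertex_iter.
exact: connected_reach.
Qed.

Lemma eq_iter_cyclic (G : fungraph) (x : G) (k l : nat) : cyclic_vertex x ->
  (iter k (@succ G) x == iter l (@succ G) x) = (k == l %[mod order (@succ G) x]).
Proof.
move=> /cyclicP/(orbitPcycle 2 4); set o := order _ x => ox.
have iter_mod j : iter (j %% o) (@succ G) x = iter j (@succ G) x.
  by rewrite {2}(divn_eq j o) addnC iterD iter_period_mul.
rewrite -(iter_mod k) -(iter_mod l); apply/eqP/eqP => [e | -> //].
have o_gt0 : 0 < o by exact: order_gt0.
by rewrite -(findex_iter (ltn_pmod k o_gt0)) e findex_iter ?ltn_pmod.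
Qed.

(** * What the counts say about cyclic vertices *)

(** A tree of any depth can be wrapped backwards around the cycle. *)
Lemma hom_cyclic_gt0 (G : fungraph) (t : rooted_tree) (v : G) :
  cyclic_vertex v -> 0 < hom t v.
Proof.
elim: t v => [|t1 IH1 t2 IH2|t IHt] v cv //=.
  by rewrite muln_gt0 IH1 ?IH2.
have [u cu su] := cyclic_pred cv.
by rewrite (bigD1 u) ?su //= addn_gt0 IHt.
Qed.

(** [iter k Plant Leaf] is the path with [k] edges, rooted at an end. *)
Lemma hom_path_gt0 (G : fungraph) k (v : G) :
  0 < hom (iter k Plant Leaf) v -> exists u, iter k (@succ G) u = v.
Proof.
elim: k v => [|k IHk] v /=; first by exists v.
rewrite lt0n sum_nat_eq0 => /forallPn[u]; rewrite negb_imply -lt0n.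
by case/andP=> /eqP su /IHk[w ew]; exists w; rewrite /= ew.
Qed.

(** The counts detect cyclicity: the cyclic vertices are those that have
    iterated predecessors at arbitrary distances, and distance [#|H|] suffices. *)
Lemma same_homs_cyclic (G H : fungraph) (v : G) (w : H) :
  same_homs v w -> cyclic_vertex v -> cyclic_vertex w.
Proof.
move=> vw cv; have := hom_cyclic_gt0 (iter #|H| Plant Leaf) cv.
by rewrite vw => /hom_path_gt0[u <-]; exact: cyclic_iter.
Qed.

(** * Graphs with the same counts are isomorphic *)

(** For equal counts at [v] and [w], the trees [Plant t] give equal sums of
    [hom t] over the two fibres of [succ], for every [t].  So the indicator of
    the first fibre minus that of the second is orthogonal to all the [hom t] on
    the disjoint union of the two graphs, and has zero total on each class. *)
Lemma same_homs_fibres (G H : fungraph) (v c : G) (w : H) : same_homs v w ->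
  #|[set u : G | (succ u == v) && `[< same_homs u c >]]| =
  #|[set u : H | (succ u == w) && `[< same_homs u c >]]|.
Proof.
move=> vw.
pose m (i : G + H) : int := match i with
  | inl u => ((succ u == v)%:R)%R | inr u => (- (succ u == w)%:R)%R end.
pose h t (i : G + H) : int := match i with
  | inl u => ((hom t u)%:R)%R | inr u => ((hom t u)%:R)%R end.
pose C (i : G + H) := match i with
  | inl u => `[< same_homs u c >] | inr u => `[< same_homs u c >] end.
have := @class_weight_eq0 int (G + H)%type rooted_tree h Leaf Join _ _ (inl c) C _ _ m _.
rewrite big_sumType /=.
rewrite GRing.sumrN -!GRing.natr_sum.
have cardE (K : fungraph) (z : K) :
    \sum_(u : K | `[< same_homs u c >]) (succ u == z)
    = #|[set u : K | (succ u == z) && `[< same_homs u c >]]|.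
  by rewrite -sum1dep_card [RHS]big_mkcondl; apply: eq_bigr => u _; case: eqP.
rewrite !cardE => main; apply/eqP; rewrite -(Num.Theory.eqr_nat int).
rewrite -GRing.subr_eq0; apply/eqP/main => {main cardE}.
- by case.
- by move=> s t [u|u] /=; rewrite GRing.natrM.
- by move=> [u|u] t /= /asboolP ->.
- move=> [u|u] /= /asboolPn/existsNP[t /eqP nt]; exists t => /=;
    by rewrite Num.Theory.eqr_nat.
- move=> t; rewrite big_sumType /=; apply/eqP.
  under [X in (_ + X)%R]eq_bigr => u _ do rewrite GRing.mulNr.
  rewrite GRing.sumrN GRing.subr_eq0.
  under eq_bigr => u _ do rewrite -GRing.natrM.
  under [X in _ == X]eq_bigr => u _ do rewrite -GRing.natrM.
  rewrite -!GRing.natr_sum Num.Theory.eqr_nat; apply/eqP.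
  have := vw (Plant t); rewrite /= !(big_mkcond (fun u => succ u == _)) /=.
  have E (K : fungraph) (z : K) : \sum_u (succ u == z) * hom t u
     = \sum_u (if succ u == z then hom t u else 0).
    by apply: eq_bigr => u _; case: (_ == z); rewrite ?mul1n.
  by rewrite !E.
Qed.

Lemma same_homs_pred (G H : fungraph) (u : G) (w : H) : same_homs (succ u) w ->
  exists2 u' : H, succ u' = w & same_homs u u'.
Proof.
move=> /(same_homs_fibres u) e.
have : u \in [set u1 : G | (succ u1 == succ u) && `[< same_homs u1 u >]].
  by rewrite inE eqxx; apply/asboolP.
move=> uin; have : 0 < #|[set u1 : H | (succ u1 == w) && `[< same_homs u1 u >]]|.
  by rewrite -e card_gt0; apply/set0Pn; exists u.
rewrite card_gt0 => /set0Pn[u']; rewrite inE => /andP[/eqP su /asboolP s].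
by exists u' => //; exact: same_homs_sym.
Qed.

(** The fibres of [succ] only give information about predecessors: equal counts
    propagate backwards along the cycles, the cyclic predecessor being unique.
    Reaching the iterates forwards uses that the two cycles close up after the
    same number [p] of steps. *)
Lemma same_homs_iter (G H : fungraph) (x : G) (y : H) (p k : nat) :
    0 < p -> iter p (@succ G) x = x -> iter p (@succ H) y = y ->
  same_homs x y -> same_homs (iter k (@succ G) x) (iter k (@succ H) y).
Proof.
move=> p_gt0 ex ey xy.
have cx : cyclic_vertex x by exists p.
have cy : cyclic_vertex y by exists p.
have back d : forall j, same_homs (iter (j + d) (@succ G) x) (iter (j + d) (@succ H) y) ->
    same_homs (iter j (@succ G) x) (iter j (@succ H) y).
  elim: d => [|d IHd] j; rewrite ?addn0 // -addSnnS => /IHd.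
  rewrite iterS => /same_homs_pred[u' su' uu'].
  suff -> : iter j (@succ H) y = u' by [].
  apply: cyclic_succ_inj; last by rewrite su'.
    exact: cyclic_vertex_iter.
  by apply: same_homs_cyclic uu' _; exact: cyclic_vertex_iter.
(* Go back to [k] from the multiple [k * p >= k] of the period. *)
apply: (back (k * p - k)); rewrite subnKC ?leq_pmulr //.
by rewrite !iter_period_mul.
Qed.

(** A partial map is encoded by its graph, a set of vertices of the product; this
    makes functionality and injectivity a single condition, and commutation
    with [succ] becomes closure under the successor of the product. *)
Record partial_iso (G H : fungraph) (D : {set fg_prod G H}) : Prop := PartialIso {
  partial_iso_inj : forall p q, p \in D -> q \in D -> (p.1 == q.1) = (p.2 == q.2);
  partial_iso_succ : forall p, p \in D -> @succ (fg_prod G H) p \in D;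
  partial_iso_homs : forall p, p \in D -> same_homs p.1 p.2 }.

Lemma iter_prod (G H : fungraph) (p : fg_prod G H) k :
  iter k (@succ (fg_prod G H)) p = (iter k (@succ G) p.1, iter k (@succ H) p.2).
Proof. by elim: k => [|k /= ->]; first case: p. Qed.

(** The orbit of [(x, y)] matches the two cycles, because both have the same
    length. *)
Lemma partial_iso_cycle (G H : fungraph) (x : G) (y : H) :
    connected G -> connected H -> cyclic_vertex x -> same_homs x y ->
    #|cyclic_vertices G| = #|cyclic_vertices H| ->
  partial_iso [set p : fg_prod G H | fconnect (@succ (fg_prod G H)) (x, y) p].
Proof.
move=> cG cH cx xy eq_p; have cy := same_homs_cyclic xy cx.
have ex := order_cyclic cG cx; have ey := order_cyclic cH cy.
split=> [p q|p|p]; rewrite !inE.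
- move=> /iter_findex <- /iter_findex <-; rewrite !iter_prod /=.
  by rewrite !eq_iter_cyclic // ex ey eq_p.
- by move/connect_trans; apply; exact: fconnect1.
move=> /iter_findex <-; rewrite iter_prod /=.
apply: (@same_homs_iter _ _ _ _ #|cyclic_vertices G|) => //.
- by rewrite -ex order_gt0.
- by apply/eqP; rewrite (eq_iter_cyclic _ 0 cx) ex modnn mod0n.
- by apply/eqP; rewrite (eq_iter_cyclic _ 0 cy) ey eq_p modnn mod0n.
Qed.

(** Among the predecessors of [succ v] with the counts of [v], at least one,
    namely [v], is not matched yet; there are as many such predecessors of [w0],
    so one of these is free as well. *)
Lemma partial_iso_extend (G H : fungraph) (D : {set fg_prod G H}) (v : G) (w0 : H) :
    partial_iso D -> (succ v, w0) \in D -> (forall w, (v, w) \notin D) ->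
  exists w, partial_iso ((v, w) |: D).
Proof.
move=> [Dinj DS Dhom] vD nv.
pose S := [set u : G | (succ u == succ v) && `[< same_homs u v >]].
pose S' := [set u : H | (succ u == w0) && `[< same_homs u v >]].
have eqS : #|S| = #|S'| by apply: same_homs_fibres; exact: (Dhom _ vD).
(* [p.1 \in S] is equivalent to [p.2 \in S'] on [D]: so the free elements of
   [S'] are those outside the image of [E]. *)
pose E := [set p in D | p.1 \in S].
have ltE : #|[set p.2 | p in E]| < #|S'|.
  apply: leq_ltn_trans (leq_imset_card _ _) _.
  rewrite -eqS -(card_in_imset (f := fst) (D := E)).
    apply: proper_card; apply/properP; split.
      by apply/subsetP=> _ /imsetP[p + ->]; rewrite inE => /andP[].
    exists v; first by rewrite inE eqxx; apply/asboolP.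
    by apply/imsetP=> [[[u w]]]; rewrite inE => /andP[/= + _] eu; rewrite -eu (negPf (nv w)).
  move=> [u w] [u' w']; rewrite !inE => /andP[pD _] /andP[qD _] /= e.
  by have := Dinj _ _ pD qD; rewrite /= e eqxx => /esym/eqP ->.
have /subsetPn[w wS' wE] : ~~ (S' \subset [set p.2 | p in E]).
  by apply: contraL ltE => /subset_leq_card; rewrite -leqNgt.
move: wS'; rewrite inE => /andP[/eqP sw /asboolP wv].
have nw u : (u, w) \notin D.
  apply: contra wE => uD; apply/imsetP; exists (u, w) => //.
  rewrite !inE uD /=; apply/andP; split.
    by have := Dinj _ _ (DS _ uD) vD; rewrite /= sw eqxx.
  by apply/asboolP=> t; rewrite (Dhom _ uD).
have fresh q : q \in D -> (v == q.1) = (w == q.2).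
  case: q => u u' /= uD; transitivity false; last apply/esym.
    by apply: contraTF uD => /eqP <-.
  by apply: contraTF uD => /eqP <-.
exists w; split=> [p q|p|p]; rewrite !in_setU1.
- move=> /orP[/eqP -> | pD] /orP[/eqP -> | qD] /=; rewrite ?eqxx ?fresh //.
    by rewrite eq_sym fresh // eq_sym.
  exact: Dinj.
- by case/orP=> [/eqP -> | /DS ->]; rewrite ?orbT // /= sw vD orbT.
by case/orP=> [/eqP -> /= t | /Dhom //]; rewrite wv.
Qed.

(** A maximal partial isomorphism containing [(x, y)] is defined everywhere: its
    domain is closed under predecessors by [partial_iso_extend], and every
    vertex leads to [x]. *)
Lemma same_homs_embedding (G H : fungraph) (x : G) (y : H) :
    connected G -> connected H -> cyclic_vertex x -> same_homs x y ->
    #|cyclic_vertices G| = #|cyclic_vertices H| ->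
  exists2 h : G -> H, injective h & forall v, h (succ v) = succ (h v).
Proof.
move=> cG cH cx xy eq_p.
pose good (D : {set fg_prod G H}) := `[< partial_iso D >] && ((x, y) \in D).
have [D maxD _] : {D | maxset good D
    & [set p : fg_prod G H | fconnect (@succ (fg_prod G H)) (x, y) p] \subset D}.
  apply: maxset_exists; rewrite /good inE connect0 andbT.
  by apply/asboolP; exact: partial_iso_cycle.
have /andP[/asboolP isoD xyD] := maxsetp maxD.
have ext v w0 : (succ v, w0) \in D -> exists w, (v, w) \in D.
  move=> vD; apply/existsP; apply: contraT; rewrite negb_exists => /forallP nv.
  have [w isoD'] := partial_iso_extend isoD vD nv.
  have D'D : (v, w) |: D = D.
    apply: (maxsetsup maxD); last exact: subsetUr.
    by rewrite /good in_setU1 xyD orbT andbT; apply/asboolP.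
  by have := nv w; rewrite -D'D setU11.
have total v : exists w, (v, w) \in D.
  have := iter_findex (@connected_reach _ x v cG cx).
  move: (findex _ v x) => k; elim: k v => [|k IHk] v; first by move=> /= ->; exists y.
  by rewrite iterSr => /IHk[w]; exact: ext.
have [h hD] := fin_all_exists total.
exists h => [u v e | v]; apply/eqP.
  by have := partial_iso_inj isoD (hD u) (hD v); rewrite /= e eqxx => ->.
have := partial_iso_inj isoD (hD (succ v)) (partial_iso_succ isoD (hD v)).
by rewrite /= eqxx => <-.
Qed.

(** Embeddings in both directions force equal cardinalities, hence bijectivity. *)
Lemma same_homs_isomorphic (G H : fungraph) (x : G) (y : H) :
    connected G -> connected H -> cyclic_vertex x -> same_homs x y ->
    #|cyclic_vertices G| = #|cyclic_vertices H| ->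
  isomorphic G H.
Proof.
move=> cG cH cx xy eq_p.
have [h h_inj hS] := same_homs_embedding cG cH cx xy eq_p.
have [h' h'_inj _] := same_homs_embedding cH cG (same_homs_cyclic xy cx)
  (same_homs_sym xy) (esym eq_p).
exists h; first by apply: inj_card_bij h_inj _; exact: leq_card h'_inj.
by move=> u v; rewrite /edge /= -hS (inj_eq h_inj).
Qed.

(** * Counting the solutions *)

(** The embedding of [B] as a component of [A * X] sends [b] to [(a, x)], and it
    keeps the counts because a component contains all predecessors of its
    vertices. *)
Lemma prod_contains_hom (A X B : fungraph) (b : B) :
    prod_contains A X B -> cyclic_vertex b ->
  exists a : A, exists x : X,
    [/\ cyclic_vertex a, cyclic_vertex x
      & forall t, hom t b = hom t a * hom t x].
Proof.
move=> [v [h h_bij hE]] [p p_gt0 pb].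
pose g (u : B) : fg_prod A X := val (h u).
have hS u : h (succ u) = succ (h u).
  by apply/eqP; have := hE u (succ u); rewrite /edge /= eqxx.
have gS u : g (succ u) = succ (g u) by rewrite /g hS.
have g_inj : injective g by move=> u u' /val_inj/(bij_inj h_bij).
have g_pred (w : fg_prod A X) u : succ w = g u -> exists u', g u' = w.
  move=> sw; have vw : connect (@adj (fg_prod A X)) v w.
    apply: connect_trans (valP (h u)) _; apply: connect1.
    by rewrite /adj /edge /= -/(g u) -sw eqxx orbT.
  have [h' _ h'K] := h_bij.
  by exists (h' (exist _ w vw)); rewrite /g h'K.
have gp : iter p (@succ (fg_prod A X)) (g b) = g b.
  by rewrite -{2}pb; elim: p {p_gt0 pb} => //= p ->; rewrite gS.
exists (g b).1, (g b).2; move: gp; rewrite iter_prod => gp.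
split; [exists p => //; exact: (congr1 fst gp) | exists p => //; exact: (congr1 snd gp) |].
by move=> t; rewrite -hom_prod hom_fibration.
Qed.

Theorem theorem3p12 (A B : fungraph) (pX : nat)
    (hA : connected A) (hB : connected B) (hpX : 1 <= pX)
    (n : nat) (X : 'I_n -> fungraph)
    (hX : forall i, [/\ connected (X i), #|cyclic_vertices (X i)| = pX
                      & prod_contains A (X i) B])
    (X_noniso : forall i j, isomorphic (X i) (X j) -> i = j) :
  n <= #|cyclic_vertices A|.
Proof.
have /card_gt0P[b0 _] := hB.1.
have cb := @cyclic_iter B _ b0 (leqnn #|B|); move: (iter _ _ _) cb => b cb {b0}.
have /fin_all_exists[a aP] i : exists a : A, exists x : X i,
    [/\ cyclic_vertex a, cyclic_vertex x & forall t, hom t b = hom t a * hom t x].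
  by have [_ _ cont] := hX i; exact: prod_contains_hom cont cb.
have a_inj : injective a.
  (* The common factor [hom t (a i)] of the counts at [b] can be cancelled. *)
  move=> i j eq_a; apply: X_noniso.
  have [[x [ca cx bx]] [y [_ cy by_]]] := (aP i, aP j).
  have [[ci pi _] [cj pj _]] := (hX i, hX j).
  apply: (same_homs_isomorphic ci cj cx (y := y)); last by rewrite pi pj.
  move=> t; apply/eqP; rewrite -(eqn_pmul2l (hom_cyclic_gt0 t ca)) -bx eq_a.
  by rewrite by_.
rewrite -[n]card_ord -(card_imset _ a_inj); apply: subset_leq_card.
apply/subsetP=> _ /imsetP[i _ ->]; rewrite inE.
by have [x [/cyclicP ca _ _]] := aP i.
Qed.
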